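(* Let $d\in\mathbb{N}$. Every finite union $\bigcup_{i=1}^k\mathcal{P}_{\rho_i}$, where each $\rho_i$ is a $0$-profile (for some radius $r_i$ and degree $d$), is a GSF-local property of undirected graphs.
   Context: $\mathcal{C}_d$ is the class of finite simple undirected graphs of maximum degree at most $d$. For a graph $G$ and vertex $v$, $\mathcal{N}_r^G(v)$ is the subgraph induced by the vertices at distance at most $r$ from $v$. An $r$-ball is a pair $(B,b)$ with $b\in V(B)$ and every vertex of $B$ at distance at most $r$ from $b$; an $r$-type is an isomorphism class of $r$-balls (isomorphisms mapping centre to centre). There are finitely many $r$-types of graphs of degree at most $d$; fix an enumeration $\tau^1,\dots,\tau^{n_{d,r}}$. The $r$-histogram vector of $G\in\mathcal{C}_d$ has $i$-th entry the number of vertices $v$ with $(\mathcal{N}_r^G(v),v)\in\tau^i$. An $r$-neighbourhood profile of degree $d$ is a map $\rho$ from $\{1,\dots,n_{d,r}\}$ to the set of intervals $[k,l]$ ($k\le l\in\mathbb{N}$) and $[k,\infty)$ ($k\in\mathbb{N}$); $G$ obeys $\rho$ if its $i$-th histogram entry lies in $\rho(i)$ for all $i$, and $\mathcal{P}_\rho:=\{G\in\mathcal{C}_d\mid G\text{ obeys }\rho\}$. A $0$-profile is a profile all of whose values are of the form $[0,k]$ or $[0,\infty)$. For a vertex $v$, $N_1^G(v)$ is $v$ together with its neighbours. A marked graph is a graph each of whose vertices is marked 'full', 'semifull' or 'partial'. An embedding of a marked graph $F$ into $G$ is an injective $f:V(F)\to V(G)$ such that for every $v\in V(F)$: if $v$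 is full, $N_1^G(f(v))=f(N_1^F(v))$; if semifull, $N_1^G(f(v))\cap f(V(F))=f(N_1^F(v))$; if partial, $N_1^G(f(v))\supseteq f(N_1^F(v))$. $G$ is $\mathcal{F}$-free if no $F\in\mathcal{F}$ embeds into $G$. A property $\mathcal{P}=\bigcup_n\mathcal{P}_n$ ($\mathcal{P}_n$ the $n$-vertex members) is GSF-local if there are a sequence $(\mathcal{F}_n)_{n\in\mathbb{N}}$ of sets of marked graphs and an integer $s$ such that for every $n$ each graph in $\mathcal{F}_n$ has at most $s$ vertices and $\mathcal{P}_n$ is exactly the set of $n$-vertex graphs that are $\mathcal{F}_n$-free. *)

(* Defs.v *)
From mathcomp Require Import all_boot.

Set Implicit Arguments.
Unset Strict Implicit.
Unset Printing Implicit Defensive.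

Record sgraph := SGraph {
  svertex :> finType;
  sedge : rel svertex;
  sedge_sym : symmetric sedge;
  sedge_irr : irreflexive sedge
}.

Definition bounded_degree (d : nat) (G : sgraph) : bool :=
  [forall v : G, #|[set u : G | sedge v u]| <= d].

Definition closed_nbh (G : sgraph) (v : G) : {set G} :=
  [set u | (u == v) || sedge v u].

(* dist(u, v) <= r, i.e. there is a walk of length n <= r from u to v. *)
Definition within_dist (G : sgraph) (r : nat) (u v : G) : bool :=
  [exists n : 'I_r.+1, exists p : n.-tuple G,
     path (@sedge G) u p && (last u p == v)].

Section Induced.
Variables (G : sgraph) (A : {set G}).

Definition induced_edge : rel {x : G | x \in A} :=
  fun x y => sedge (val x) (val y).

Lemma induced_edge_sym : symmetric induced_edge.
Proof. by move=> x y; apply: sedge_sym. Qed.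

Lemma induced_edge_irr : irreflexive induced_edge.
Proof. by move=> x; apply: sedge_irr. Qed.

Definition induced : sgraph := SGraph induced_edge_sym induced_edge_irr.
End Induced.

Record rooted := Rooted {
  rgraph :> sgraph;
  root : rgraph
}.

Definition is_ball (r : nat) (B : rooted) : bool :=
  [forall v : B, within_dist r (root B) v].

Definition rooted_iso (B1 B2 : rooted) : bool :=
  [exists f : {ffun B1 -> B2},
    [&& injectiveb f, [forall y, y \in codom f], f (root B1) == root B2
      & [forall u, forall v, sedge (f u) (f v) == sedge u v]]].

Lemma within_dist_refl (G : sgraph) (r : nat) (v : G) : within_dist r v v.
Proof.
by apply/existsP; exists ord0; apply/existsP; exists [tuple]; rewrite /= eqxx.
Qed.

Definition ball_set (G : sgraph) (r : nat) (v : G) : {set G} :=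
  [set u | within_dist r v u].

Lemma center_in_ball (G : sgraph) (r : nat) (v : G) : v \in ball_set r v.
Proof. by rewrite inE within_dist_refl. Qed.

Definition nbhood (G : sgraph) (r : nat) (v : G) : rooted :=
  @Rooted (induced (ball_set r v)) (exist _ v (center_in_ball r v)).

(* An enumeration without repetition of the r-types of degree at most d, each
   isomorphism class being given by a representative.  The theorem is stated
   for an arbitrary such enumeration; rtype_enum_exists below shows that there
   always is one. *)
Record rtype_enum (d r : nat) := RTypeEnum {
  ntypes : nat;
  type_rep : 'I_ntypes -> rooted;
  type_rep_ball : forall i, is_ball r (type_rep i);
  type_rep_deg : forall i, bounded_degree d (type_rep i);
  type_rep_inj : forall i j, rooted_iso (type_rep i) (type_rep j) -> i = j;
  type_rep_surj : forall B : rooted, is_ball r B -> bounded_degree d B ->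
    exists i, rooted_iso B (type_rep i)
}.

Definition histogram (d r : nat) (tau : rtype_enum d r) (G : sgraph)
    (i : 'I_(ntypes tau)) : nat :=
  #|[set v : G | rooted_iso (nbhood r v) (type_rep i)]|.

Inductive interval :=
  | Bounded (k l : nat) of k <= l
  | Unbounded (k : nat).

Definition in_interval (m : nat) (I : interval) : bool :=
  match I with
  | Bounded k l _ => k <= m <= l
  | Unbounded k => k <= m
  end.

Definition lower_end (I : interval) : nat :=
  match I with Bounded k _ _ => k | Unbounded k => k end.

Definition profile (d r : nat) (tau : rtype_enum d r) : Type :=
  'I_(ntypes tau) -> interval.

Definition zero_profile (d r : nat) (tau : rtype_enum d r)
    (rho : profile tau) : Prop :=
  forall i, lower_end (rho i) = 0.

Definition obeys (d r : nat) (tau : rtype_enum d r) (rho : profile tau)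
    (G : sgraph) : Prop :=
  forall i, in_interval (histogram G i) (rho i).

Definition profile_property (d r : nat) (tau : rtype_enum d r)
    (rho : profile tau) (G : sgraph) : Prop :=
  bounded_degree d G /\ obeys rho G.

Inductive marking := Full | Semifull | Partial.

Record mgraph := MGraph {
  mbase :> sgraph;
  mark : mbase -> marking
}.

Definition embedding (F : mgraph) (G : sgraph) (f : F -> G) : Prop :=
  injective f /\
  forall v : F,
    match mark v with
    | Full => closed_nbh (f v) = f @: closed_nbh v
    | Semifull => closed_nbh (f v) :&: f @: [set: F] = f @: closed_nbh v
    | Partial => f @: closed_nbh v \subset closed_nbh (f v)
    end.

Definition free_of (Fs : mgraph -> Prop) (G : sgraph) : Prop :=
  forall F : mgraph, Fs F -> ~ exists f : F -> G, embedding f.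

Definition GSF_local (P : sgraph -> Prop) : Prop :=
  exists (Fs : nat -> mgraph -> Prop) (s : nat),
    forall n : nat,
      (forall F : mgraph, Fs n F -> #|F| <= s) /\
      (forall G : sgraph, #|G| = n -> (P G <-> free_of (Fs n) G)).

Section Existence.

Lemma rooted_isoP (B1 B2 : rooted) :
  reflect (exists f : B1 -> B2, [/\ bijective f, f (root B1) = root B2
             & forall u v, sedge (f u) (f v) = sedge u v])
          (rooted_iso B1 B2).
Proof.
apply: (iffP existsP) => [[f]|[f [fbij froot fE]]].
  case/and4P=> /injectiveP finj /forallP fsurj /eqP froot /forallP fE.
  exists f; split=> // [|u v]; last exact/eqP/(forallP (fE u)).
  by exists (fun y => iinv (fsurj y)) => [x|y]; rewrite ?f_iinv ?iinv_f.
exists (finfun f); apply/and4P; split.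
- by apply/injectiveP=> x y; rewrite !ffunE; apply: bij_inj.
- apply/forallP=> y; case: fbij => g fK gK; apply/codomP; exists (g y).
  by rewrite ffunE gK.
- by rewrite ffunE froot.
- by apply/forallP=> u; apply/forallP=> v; rewrite !ffunE fE.
Qed.

Lemma rooted_iso_sym (B1 B2 : rooted) : rooted_iso B1 B2 -> rooted_iso B2 B1.
Proof.
case/rooted_isoP=> f [[g fK gK] froot fE]; apply/rooted_isoP; exists g; split.
- by exists f.
- by rewrite -froot fK.
- by move=> u v; rewrite -fE !gK.
Qed.

Lemma rooted_iso_trans (B1 B2 B3 : rooted) :
  rooted_iso B1 B2 -> rooted_iso B2 B3 -> rooted_iso B1 B3.
Proof.
case/rooted_isoP=> f [fb froot fE]; case/rooted_isoP=> g [gb groot gE].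
apply/rooted_isoP; exists (g \o f); split; first exact: bij_comp.
  by rewrite /= froot.
by move=> u v; rewrite /= gE fE.
Qed.

Lemma within_distP (G : sgraph) r (u v : G) :
  reflect (exists p, [/\ path (@sedge G) u p, last u p = v & size p <= r])
          (within_dist r u v).
Proof.
apply: (iffP existsP) => [[n /existsP[p /andP[pp /eqP lp]]]|[p [pp lp sp]]].
  by exists p; split; rewrite // size_tuple -ltnS.
exists (Ordinal (sp : size p < r.+1)); apply/existsP; exists (in_tuple p).
by rewrite /= pp lp eqxx.
Qed.

Lemma within_dist_iso (B1 B2 : rooted) (f : B1 -> B2) r u v :
  (forall u v, sedge (f u) (f v) = sedge u v) ->
  within_dist r u v -> within_dist r (f u) (f v).
Proof.
move=> fE /within_distP[p [pp <- sp]]; apply/within_distP; exists (map f p).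
rewrite last_map size_map; split=> //.
by elim: p u pp {sp} => //= x p IHp u /andP[ux xp]; rewrite fE ux IHp.
Qed.

Lemma is_ball_iso (B1 B2 : rooted) r :
  rooted_iso B1 B2 -> is_ball r B1 -> is_ball r B2.
Proof.
case/rooted_isoP=> f [[g _ gK] froot fE] /forallP b1; apply/forallP=> v.
by rewrite -froot -(gK v); apply: within_dist_iso.
Qed.

Lemma bounded_degree_iso (B1 B2 : rooted) d :
  rooted_iso B1 B2 -> bounded_degree d B1 -> bounded_degree d B2.
Proof.
case/rooted_isoP=> f [[g fK gK] froot fE] /forallP b1; apply/forallP=> v.
apply: leq_trans (b1 (g v)).
rewrite -(card_imset _ (can_inj gK)); apply/subset_leq_card/subsetP => y.
by case/imsetP=> x; rewrite inE => vx ->; rewrite inE -fE !gK.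
Qed.

Lemma ball_set_card (G : sgraph) d r (v : G) :
  bounded_degree d G -> #|ball_set r v| <= d.+1 ^ r.
Proof.
move=> /forallP dG; elim: r => [|r IHr].
  rewrite expn0 -(cards1 v); apply/subset_leq_card/subsetP => u.
  rewrite !inE => /within_distP[p [_ <-]].
  by rewrite leqn0 size_eq0 => /eqP ->.
have nbh_card (w : G) : #|closed_nbh w| <= d.+1.
  have -> : closed_nbh w = w |: [set u | sedge w u] by apply/setP=> u; rewrite !inE.
  by rewrite cardsU1 inE sedge_irr add1n ltnS.
have sub : ball_set r.+1 v \subset \bigcup_(w in ball_set r v) closed_nbh w.
  apply/subsetP=> u; rewrite inE => /within_distP[p [pp <- sp]].
  case/lastP: p pp sp => [_ _|p x].
    by apply/bigcupP; exists v; rewrite ?center_in_ball // inE eqxx.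
  rewrite rcons_path size_rcons last_rcons ltnS => /andP[pp ex] sp.
  apply/bigcupP; exists (last v p); last by rewrite inE ex orbT.
  by rewrite inE; apply/within_distP; exists p.
apply: leq_trans (subset_leq_card sub) _.
apply: (@leq_trans (\sum_(w in ball_set r v) d.+1)).
  apply: (@leq_trans (\sum_(w in ball_set r v) #|closed_nbh w|)); last first.
    by apply: leq_sum => w _.
  elim/big_rec2: _ => [|w A m _ IH]; first by rewrite cards0.
  by apply: leq_trans (leq_card_setU _ _).1 _; rewrite leq_add2l.
by rewrite sum_nat_const expnSr leq_mul2r IHr orbT.
Qed.

Lemma ball_card d r (B : rooted) :
  is_ball r B -> bounded_degree d B -> #|B| <= d.+1 ^ r.
Proof.
move=> /forallP ball dB; apply: leq_trans (ball_set_card r (root B) dB).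
by apply/subset_leq_card/subsetP => u _; rewrite inE.
Qed.

Section Code.
Variables (m : nat) (E : {set 'I_m * 'I_m}).
Definition code_edge : rel 'I_m :=
  fun x y => (x != y) && (((x, y) \in E) || ((y, x) \in E)).
Lemma code_edge_sym : symmetric code_edge.
Proof. by move=> x y; rewrite /code_edge eq_sym orbC. Qed.
Lemma code_edge_irr : irreflexive code_edge.
Proof. by move=> x; rewrite /code_edge eqxx. Qed.
Definition code_graph : sgraph := SGraph code_edge_sym code_edge_irr.
End Code.

Definition codes (m : nat) : seq rooted :=
  [seq @Rooted (code_graph E) x | E <- enum {set 'I_m * 'I_m}, x <- enum 'I_m].

Lemma has_flatten (T : Type) (a : pred T) (ss : seq (seq T)) :
  has a (flatten ss) = has (has a) ss.
Proof. by elim: ss => //= s ss IHss; rewrite has_cat IHss. Qed.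

Lemma codes_complete (B : rooted) : has (rooted_iso B) (codes #|B|).
Proof.
pose E := [set p : 'I_#|B| * 'I_#|B| | sedge (enum_val p.1) (enum_val p.2)].
pose x := enum_rank (root B).
have iso : rooted_iso B (@Rooted (code_graph E) x).
  apply/rooted_isoP; exists enum_rank; split=> //.
    by exists enum_val => y; rewrite ?enum_rankK ?enum_valK.
  move=> u v; rewrite /= /code_edge !inE /= !enum_rankK.
  rewrite (inj_eq enum_rank_inj) [sedge v u]sedge_sym orbb.
  by case: eqP => //= ->; rewrite sedge_irr.
rewrite /codes has_flatten has_map; apply/hasP; exists E.
  by rewrite mem_enum.
by rewrite /= has_map; apply/hasP; exists x => //; rewrite mem_enum.
Qed.

Lemma dedup (s : seq rooted) :
  exists t : seq rooted, pairwise (fun x y => ~~ rooted_iso x y) t /\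
    (forall a : pred rooted, all a s -> all a t) /\
    (forall B, has (rooted_iso B) s -> has (rooted_iso B) t).
Proof.
elim: s => [|x s [t [pt [allt hast]]]]; first by exists [::].
case: (boolP (has (rooted_iso x) t)) => xt.
  exists t; split=> //; split=> [a /andP[_ /allt] //|B /= /orP[Bx|/hast //]].
  by apply: sub_has xt => y; apply: rooted_iso_trans.
exists (x :: t); split; first by rewrite /= pt andbT all_predC.
split=> [a /= /andP[-> /allt] //|B /= /orP[-> //|/hast ->]].
by rewrite orbT.
Qed.

Lemma rtype_enum_exists (d r : nat) : inhabited (rtype_enum d r).
Proof.
pose ok B := is_ball r B && bounded_degree d B.
pose s := filter ok (flatten (map codes (iota 0 (d.+1 ^ r).+1))).
have s_ok : all ok s by apply: filter_all.
have s_compl B : ok B -> has (rooted_iso B) s.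
  move=> okB; have /andP[bB dB] := okB.
  have : has (rooted_iso B) (flatten (map codes (iota 0 (d.+1 ^ r).+1))).
    rewrite has_flatten has_map; apply/hasP; exists #|B|.
      by rewrite mem_iota add0n ltnS; apply: ball_card.
    exact: codes_complete.
  rewrite /s; elim: (flatten _) => //= C u IHu /orP[BC|/IHu hu].
    by rewrite /ok (is_ball_iso BC) ?(bounded_degree_iso BC) //= BC.
  by case: (ok C); rewrite //= hu orbT.
have [t [pt [allt hast]]] := dedup s.
have t_ok := allt _ s_ok.
have t_compl B (okB : ok B) := hast _ (s_compl B okB).
case: t pt t_ok t_compl {allt hast} => [|x0 t'].
  move=> _ _ no; constructor.
  apply: (@RTypeEnum d r 0 (fun i => False_rect _ (notF (ltn_ord i)))).
  - by case.
  - by case.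
  - by case.
  - by move=> B b dB; move: (no B); rewrite /ok b dB => /(_ isT).
set t := x0 :: t' => pt /all_nthP t_ok t_compl; constructor.
have noniso (i j : 'I_(size t)) : i < j -> ~~ rooted_iso (nth x0 t i) (nth x0 t j).
  by move=> ij; apply: (pairwiseP x0 pt) => //; apply: ltn_ord.
apply: (@RTypeEnum d r (size t) (fun i => nth x0 t i)).
- by move=> i; case/andP: (t_ok x0 i (ltn_ord i)).
- by move=> i; case/andP: (t_ok x0 i (ltn_ord i)).
- move=> i j ij; apply: val_inj; case: (ltngtP i j) => // lt.
    by move: (noniso _ _ lt); rewrite ij.
  by move: (noniso _ _ lt); rewrite (rooted_iso_sym ij).
- move=> B b dB; have: has (rooted_iso B) t by apply: t_compl; rewrite /ok b.
  by case/(has_nthP x0) => i it iso; exists (Ordinal it).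
Qed.

End Existence.

(* Main.v *)
Require Import Defs.
From mathcomp Require Import all_boot.

(** A graph of large degree, or one in which some type occurs too often, already
shows this on finitely many vertices [A]: a vertex with too many neighbours, or
the balls around sufficiently many centres of that type.  Mark the subgraph
induced on [A] by [Full] where the whole neighbourhood lies in [A] and by
[Semifull] elsewhere.  An embedding of it into a graph [H] carries these balls
onto balls of [H], so [H] is bad for the same reason.  Such obstructions remain
obstructions when [A] grows, so a graph outside a finite union of properties is
obstructed by the union of its obstructions to each of them.  A property with
obstructions of bounded size is GSF-local: forbid all marked graphs of that size
that embed into none of its members. *)

Set Implicit Arguments.
Unset Strict Implicit.
Unset Printing Implicit Defensive.

Lemma leq_card_bigcup (I T : finType) (P : pred I) (A : I -> {set T}) :
  #|\bigcup_(i | P i) A i| <= \sum_(i | P i) #|A i|.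
Proof.
elim/big_rec2: _ => [|i m B _ leBm]; first by rewrite cards0.
by apply: leq_trans (leq_card_setU _ _).1 _; rewrite leq_add2l.
Qed.

Lemma subset_of_card (T : finType) (A : {set T}) n :
  n <= #|A| -> exists2 S : {set T}, S \subset A & #|S| = n.
Proof.
case/card_geqP=> s [s_uniq <- sA]; exists [set:: s].
  by apply/subsetP=> x; rewrite inE => /sA.
by rewrite cardsE; apply/card_uniqP.
Qed.

Lemma leq_card_subtype (T U : finType) (P : pred T) (sT : subFinType P)
    (f : sT -> U) (A : {set T}) (B : {set U}) :
  injective f -> {subset A <= P} -> (forall x, val x \in A -> f x \in B) ->
  #|A| <= #|B|.
Proof.
move=> f_inj AP fAB; pose A' := [set x : sT | val x \in A].
have -> : A = val @: A'.
  apply/setP=> y; apply/idP/imsetP=> [yA|[x + ->]]; last by rewrite inE.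
  by exists (Sub y (AP y yA)); rewrite ?inE SubK.
rewrite (card_imset _ val_inj) -(card_imset _ f_inj).
by apply/subset_leq_card/subsetP=> _ /imsetP[x + ->]; rewrite inE => /fAB.
Qed.

Lemma card_rooted_iso (B1 B2 : rooted) : rooted_iso B1 B2 -> #|B1| = #|B2|.
Proof. by case/rooted_isoP=> f [f_bij _ _]; apply: bij_eq_card f_bij. Qed.

Section Balls.
Variables (G : sgraph) (v : G).

Lemma ball_set0 : ball_set 0 v = [set v].
Proof.
apply/setP=> u; rewrite !inE.
apply/idP/eqP=> [|->]; last exact: within_dist_refl.
by case/within_distP=> p [_ <-]; rewrite leqn0 size_eq0 => /eqP ->.
Qed.

Lemma ball_setS r : ball_set r.+1 v = \bigcup_(u in ball_set r v) closed_nbh u.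
Proof.
apply/setP=> w; rewrite inE.
apply/within_distP/bigcupP=> [[p [v_p <- p_le]]|[u]].
  case/lastP: p v_p p_le => [_ _|p x].
    by exists v; rewrite ?center_in_ball // inE eqxx.
  rewrite rcons_path size_rcons last_rcons ltnS => /andP[v_p px] p_le.
  by exists (last v p); rewrite inE ?px ?orbT //; apply/within_distP; exists p.
rewrite !inE => /within_distP[p [v_p p_u p_le]] /orP[/eqP -> | uw].
  by exists p; split=> //; apply: leqW.
by exists (rcons p w); rewrite rcons_path last_rcons size_rcons p_u v_p.
Qed.

Lemma subset_ball_set m n : m <= n -> ball_set m v \subset ball_set n v.
Proof.
move=> mn; apply/subsetP=> u; rewrite !inE => /within_distP[p [v_p p_u p_le]].
by apply/within_distP; exists p; split=> //; apply: leq_trans mn.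
Qed.

Lemma closed_nbh_sub_ball_set r u :
  u \in ball_set r v -> closed_nbh u \subset ball_set r.+1 v.
Proof. by move=> vu; rewrite ball_setS (bigcup_sup u). Qed.

Lemma card_nbhood r : #|nbhood r v| = #|ball_set r v|.
Proof. exact: card_sig. Qed.

End Balls.

(* The [r]-ball around [v] is explored along edges leaving vertices at distance
   less than [r], hence nothing is required of those at distance [r]. *)
Definition full_interior (F : mgraph) (r : nat) (v : F) : Prop :=
  forall n, n < r -> {in ball_set n v, forall u, mark u = Full}.

Section PartialFreeEmbedding.
Variables (F : mgraph) (H : sgraph) (f : F -> H).
Hypotheses (f_emb : embedding f) (no_partial : forall v : F, mark v <> Partial).

Lemma embedding_sedge u v : sedge (f u) (f v) = sedge u v.
Proof.
have [f_inj f_mark] := f_emb.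
have: (f v \in closed_nbh (f u)) = (v \in closed_nbh u).
  rewrite -(mem_imset (closed_nbh u) v f_inj).
  move: (f_mark u) (@no_partial u); case: (mark u) => // <- // _.
  by rewrite in_setI imset_f ?inE // andbT.
by rewrite !inE (inj_eq f_inj); case: eqP => //= ->; rewrite !sedge_irr.
Qed.

Lemma embedding_ball_set r v :
  full_interior r v -> ball_set r (f v) = f @: ball_set r v.
Proof.
have [f_inj f_mark] := f_emb.
elim: r => [|r IHr] full; first by rewrite !ball_set0 imset_set1.
rewrite !ball_setS IHr => [|n nr]; last exact/full/ltnW.
rewrite (big_morph _ (imsetU f) (imset0 f)) big_imset => [|x y _ _ /f_inj //].
by apply: eq_bigr => u ru; have := f_mark u; rewrite (full r).
Qed.

Lemma embedding_nbhood r v :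
  full_interior r v -> rooted_iso (nbhood r v) (nbhood r (f v)).
Proof.
move=> full; have ballE := embedding_ball_set full; have [f_inj _] := f_emb.
have f_in_ball (x : nbhood r v) : f (val x) \in ball_set r (f v).
  by rewrite ballE imset_f //; apply: valP x.
pose g (x : nbhood r v) : nbhood r (f v) := exist _ (f (val x)) (f_in_ball x).
apply/rooted_isoP; exists g; split.
- apply: inj_card_bij => [x y /(congr1 val)/= /f_inj/val_inj //|].
  by rewrite !card_nbhood ballE card_imset.
- exact: val_inj.
- by move=> x y; apply: embedding_sedge.
Qed.

End PartialFreeEmbedding.

Section MarkedInduced.
Variables (G : sgraph) (A : {set G}).

Definition marked_induced : mgraph :=
  @MGraph (induced A)
    (fun x => if closed_nbh (val x) \subset A then Full else Semifull).

Lemma marked_induced_no_partial (x : marked_induced) : mark x <> Partial.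
Proof. by rewrite /=; case: ifP. Qed.

Lemma card_marked_induced : #|marked_induced| = #|A|.
Proof. exact: card_sig. Qed.

Lemma marked_induced_embedding : embedding (val : marked_induced -> G).
Proof.
have imset_valE (B : {set G}) (C : {set marked_induced}) :
    (forall x, (x \in C) = (val x \in B)) -> val @: C = B :&: A.
  move=> CB; apply/setP=> y; rewrite inE.
  apply/imsetP/andP=> [[x + ->]|[yB yA]].
    by rewrite CB; split=> //; apply: valP x.
  by exists (exist _ y yA); rewrite ?CB.
split=> [|x]; first exact: val_inj.
rewrite /= (imset_valE (closed_nbh (val x))) => [|y]; last by rewrite !inE.
case: ifP => [/setIidPl -> //|_].
by rewrite (imset_valE setT) ?setTI // => y; rewrite !inE.
Qed.

Lemma marked_induced_full_interior r (v : marked_induced) :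
  ball_set r (val v) \subset A -> full_interior r v.
Proof.
move=> ballA n nr u; rewrite inE => vu /=; rewrite ifT //.
apply: subset_trans ballA; apply: subset_trans (subset_ball_set _ nr).
apply: closed_nbh_sub_ball_set; rewrite inE.
exact: (@within_dist_iso (Rooted v) (Rooted (val v)) val).
Qed.

Lemma marked_induced_nbhood r (H : sgraph) (f : marked_induced -> H)
    (v : marked_induced) :
  embedding f -> ball_set r (val v) \subset A ->
  rooted_iso (nbhood r (f v)) (nbhood r (val v)).
Proof.
move=> f_emb /marked_induced_full_interior full.
have no_partial := marked_induced_no_partial.
have f_iso := embedding_nbhood f_emb no_partial full.
have val_iso := embedding_nbhood marked_induced_embedding no_partial full.
exact: rooted_iso_trans (rooted_iso_sym f_iso) val_iso.
Qed.

End MarkedInduced.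

(* Quantifying over the supersets [B] of [A] is what lets obstructions to
   several properties be combined by taking their union. *)
Definition obstruction (P : pred sgraph) (G : sgraph) (A : {set G}) : Prop :=
  forall (B : {set G}) (H : sgraph) (f : marked_induced B -> H),
    A \subset B -> embedding f -> ~~ P H.

Definition bounded_obstructions (P : pred sgraph) : Prop :=
  exists s, forall G, ~~ P G ->
    exists2 A : {set G}, #|A| <= s & obstruction P A.

Lemma bounded_obstructions_GSF_local (P : sgraph -> Prop) (p : pred sgraph) :
  (forall G, reflect (P G) (p G)) -> bounded_obstructions p -> GSF_local P.
Proof.
move=> P_p [s obs].
exists (fun _ (F : mgraph) => #|F| <= s /\
          forall H, P H -> ~ exists f : F -> H, embedding f).
exists s => n; split=> [F [] //|G _]; split=> [PG F [_ /(_ G PG)] //|G_free].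
apply/P_p/negPn/negP=> /obs[A As obsA].
apply: (G_free (marked_induced A)); last first.
  by exists val; apply: marked_induced_embedding.
rewrite card_marked_induced; split=> // H /P_p pH [f f_emb].
by have := obsA A H f (subxx A) f_emb; rewrite pH.
Qed.

Lemma bounded_obstructions_and (P Q : pred sgraph) :
  bounded_obstructions P -> bounded_obstructions Q ->
  bounded_obstructions (fun G => P G && Q G).
Proof.
move=> [s obsP] [t obsQ]; exists (maxn s t) => G.
rewrite negb_and => /orP[/obsP[A As obsA]|/obsQ[A At obsA]]; exists A.
- by rewrite leq_max As.
- by move=> B H f AB f_emb; rewrite negb_and (obsA B H f).
- by rewrite leq_max At orbT.
- by move=> B H f AB f_emb; rewrite negb_and (obsA B H f) ?orbT.
Qed.

Section FiniteFamily.
Variables (I : finType) (P : I -> pred sgraph).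
Hypothesis P_obs : forall i, bounded_obstructions (P i).

Lemma bounded_obstructions_forall :
  bounded_obstructions (fun G => [forall i, P i G]).
Proof.
have [s obs] := fin_all_exists P_obs; exists (\max_i s i) => G.
case/forallPn=> i /obs[A As obsA]; exists A.
  exact: leq_trans (leq_bigmax i).
by move=> B H f AB f_emb; apply/forallPn; exists i; apply: obsA f_emb.
Qed.

Lemma bounded_obstructions_exists :
  bounded_obstructions (fun G => [exists i, P i G]).
Proof.
have [s obs] := fin_all_exists P_obs; exists (\sum_i s i) => G /existsPn nP.
have [A As obsA] := fin_all_exists2 (fun i => obs i G (nP i)).
exists (\bigcup_i A i) => [|B H f /bigcupsP AB f_emb].
  by apply: leq_trans (leq_card_bigcup _ _) _; apply: leq_sum.
by apply/existsPn=> i; apply: obsA f_emb; apply: AB.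
Qed.

End FiniteFamily.

Lemma bounded_degree_bounded_obstructions d :
  bounded_obstructions (bounded_degree d).
Proof.
exists d.+2 => G /forallPn[v]; rewrite -ltnNge => /subset_of_card[S Sv S_card].
exists (v |: S) => [|B H f].
  by rewrite cardsU1 S_card -[d.+2]add1n leq_add2r leq_b1.
rewrite subUset sub1set => /andP[vB /subsetP SB] f_emb.
apply/forallPn; exists (f (exist _ v vB)); rewrite -ltnNge -S_card.
apply: leq_card_subtype f_emb.1 SB _ => x /(subsetP Sv); rewrite !inE.
by rewrite (embedding_sedge f_emb (@marked_induced_no_partial _ _)).
Qed.

Definition occurrences (r : nat) (B : rooted) (G : sgraph) : {set G} :=
  [set v | rooted_iso (nbhood r v) B].

Lemma card_bigcup_ball_set r (B : rooted) (G : sgraph) (S : {set G}) :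
  S \subset occurrences r B G ->
  #|\bigcup_(v in S) ball_set r v| <= #|S| * #|B|.
Proof.
move=> /subsetP S_occ; apply: leq_trans (leq_card_bigcup _ _) _.
rewrite -sum_nat_const; apply: leq_sum => v /S_occ.
by rewrite inE -card_nbhood => /card_rooted_iso ->.
Qed.

Lemma leq_occurrences_embedding r (B : rooted) (G : sgraph) (A S : {set G})
    (H : sgraph) (f : marked_induced A -> H) :
  embedding f -> S \subset occurrences r B G ->
  \bigcup_(v in S) ball_set r v \subset A -> #|S| <= #|occurrences r B H|.
Proof.
move=> f_emb /subsetP S_occ /bigcupsP ballA.
apply: (leq_card_subtype f_emb.1) => [v vS|x xS].
  exact/(subsetP (ballA v vS))/center_in_ball.
have := S_occ _ xS; rewrite !inE; apply: rooted_iso_trans.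
exact: marked_induced_nbhood f_emb (ballA _ xS).
Qed.

Lemma occurrences_leq_bounded_obstructions r (B : rooted) l :
  bounded_obstructions (fun G => #|occurrences r B G| <= l).
Proof.
exists (l.+1 * #|B|) => G; rewrite -ltnNge => /subset_of_card[S S_occ S_card].
exists (\bigcup_(v in S) ball_set r v) => [|A H f SA f_emb].
  by rewrite -S_card; apply: card_bigcup_ball_set.
by rewrite -ltnNge -S_card; apply: leq_occurrences_embedding f_emb S_occ SA.
Qed.

Lemma occurrences_in_interval_bounded_obstructions r (B : rooted)
    (I : interval) :
  lower_end I = 0 ->
  bounded_obstructions (fun G => in_interval #|occurrences r B G| I).
Proof.
case: I => [k l kl|k] /= ->; last by exists 0.
exact: occurrences_leq_bounded_obstructions.
Qed.

Definition profile_pred (d r : nat) (tau : rtype_enum d r) (rho : profile tau) :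
    pred sgraph :=
  fun G => bounded_degree d G &&
    [forall i, in_interval (histogram G i) (rho i)].

Lemma profile_propertyP (d r : nat) (tau : rtype_enum d r) (rho : profile tau)
    (G : sgraph) :
  reflect (profile_property rho G) (profile_pred rho G).
Proof. by apply: (iffP andP) => -[dG /forallP]. Qed.

Lemma zero_profile_bounded_obstructions (d r : nat) (tau : rtype_enum d r)
    (rho : profile tau) :
  zero_profile rho -> bounded_obstructions (profile_pred rho).
Proof.
move=> rho0; apply: bounded_obstructions_and.
  exact: bounded_degree_bounded_obstructions.
apply: bounded_obstructions_forall => i.
exact: occurrences_in_interval_bounded_obstructions.
Qed.

Theorem theorem7p11 (d : nat) (tau : forall r : nat, rtype_enum d r)
    (k : nat) (r : 'I_k -> nat) (rho : forall i : 'I_k, profile (tau (r i))) :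
  (forall i : 'I_k, zero_profile (rho i)) ->
  GSF_local (fun G : sgraph => exists i : 'I_k, profile_property (rho i) G).
Proof.
move=> rho0.
apply: (@bounded_obstructions_GSF_local _
         (fun G => [exists i, profile_pred (rho i) G])) => [G|].
  by apply: (iffP existsP) => -[i /profile_propertyP]; exists i.
apply: bounded_obstructions_exists => i.
exact: zero_profile_bounded_obstructions.
Qed.
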